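(* If $0\in\widehat{\partial}F(x^{\star})$, then for $c_{\star}=1/g(x^{\star})$ it holds that $$0\in\widehat{\partial}_x\widetilde{F}(x^{\star},c_{\star})\quad\text{and}\quad 0=\nabla_c\widetilde{F}(x^{\star},c_{\star}).$$ Conversely, if $(x^{\star},c_{\star})\in(\Omega\cap\mathcal{C})\times\mathbb{R}$ satisfies $0\in\widehat{\partial}_x\widetilde{F}(x^{\star},c_{\star})$ and $0=\nabla_c\widetilde{F}(x^{\star},c_{\star})$, then $0\in\widehat{\partial}F(x^{\star})$.
   Context: Setting: $f,g:\mathbb{R}^n\to[0,+\infty)$ and $h:\mathbb{R}^n\to\mathbb{R}$ are proper closed (lower semicontinuous), $\mathcal{C}\subseteq\mathbb{R}^n$ is closed, $\Omega:=\{x\in\mathbb{R}^n: g(x)\neq 0\}$, and $\mathcal{C}\cap\Omega\neq\emptyset$. Standing assumptions: (i) $f$ is locally Lipschitz continuous on $\Omega$; (ii) $g$ is convex on $\mathbb{R}^n$; (iii) $h=h_1-h_2$, where $h_1:\mathbb{R}^n\to\mathbb{R}$ is locally Lipschitz differentiable around each $x\in\Omega$ (each $x\in\Omega$ has a ball on which $h_1$ is continuously differentiable with Lipschitz gradient) and $h_2:\mathbb{R}^n\to\mathbb{R}$ is convex. $F:\mathbb{R}^n\to(-\infty,+\infty]$ is defined by $F(x)=f(x)/g(x)+h(x)$ if $x\in\Omega\cap\mathcal{C}$ and $F(x)=+\infty$ otherwise. $\widetilde{F}(x,c):=2cf(x)-c^2f(x)g(x)+h(x)+\iota_{\Omega\cap\mathcal{C}}(x)$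 for $(x,c)\in\mathbb{R}^n\times\mathbb{R}$, where $\iota_{\Omega\cap\mathcal{C}}$ is $0$ on $\Omega\cap\mathcal{C}$ and $+\infty$ elsewhere. Fréchet subdifferential: for proper $\varphi:\mathbb{R}^n\to(-\infty,+\infty]$ and $x\in\mathrm{dom}(\varphi)$, $\widehat{\partial}\varphi(x):=\{y\in\mathbb{R}^n:\liminf_{z\to x,z\neq x}\frac{\varphi(z)-\varphi(x)-\langle y,z-x\rangle}{\|z-x\|_2}\geq0\}$; $\widehat\partial\varphi(x)=\emptyset$ if $x\notin\mathrm{dom}(\varphi)$. For $(x,c)\in(\Omega\cap\mathcal{C})\times\mathbb{R}$, $\widehat{\partial}_x\widetilde{F}(x,c)$ is the Fréchet subdifferential of $\widetilde{F}(\cdot,c)$ at $x$, and $\nabla_c\widetilde{F}(x,c)$ is the partial derivative of $\widetilde{F}$ with respect to $c$. *)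

(* Defs.v *)
From HB Require Import structures.
From mathcomp Require Import all_boot all_order all_algebra.
From mathcomp Require Import all_classical all_reals all_analysis.

Set Implicit Arguments.
Unset Strict Implicit.
Unset Printing Implicit Defensive.

Import Order.TTheory GRing.Theory Num.Theory.
Import numFieldNormedType.Exports.

Local Open Scope classical_set_scope.
Local Open Scope ring_scope.

(* R^n is 'rV[R]_n. The library norm `|x| on 'rV[R]_n is the sup norm: it gives
   the usual topology and is used below only in norm-independent notions
   (neighbourhoods, differentiability, Lipschitz continuity with an
   unspecified constant). The Fréchet quotient uses the Euclidean norm. *)

Section Euclidean.
Variables (R : realType) (n : nat).
Implicit Types (x y z : 'rV[R]_n).

Definition dot x y : R := \sum_(i < n) x ord0 i * y ord0 i.

Definition enorm x : R := Num.sqrt (dot x x).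

Definition gradient (phi : 'rV[R]_n -> R) x : 'rV[R]_n :=
  \row_(i < n) 'D_(delta_mx ord0 i) phi x.

(* When n = 0, the punctured neighbourhood filter x^' is improper and the
   liminf is +oo (infimum over the empty set). *)
Definition frechet_subdiff (phi : 'rV[R]_n -> \bar R) x : set 'rV[R]_n :=
  [set y | (phi x < +oo)%E /\
    (0%E <= limf_einf
      (fun z => (phi z - phi x - (dot y (z - x))%:E)
                * (enorm (z - x))^-1%:E)%E x^')%E].

Definition lsc (phi : 'rV[R]_n -> R) : Prop :=
  lower_semicontinuous (EFin \o phi).

Definition convex_on_space (phi : 'rV[R]_n -> R) : Prop :=
  convex_function (setT : set (convex_lmodType 'rV[R]_n)) phi.

Definition locally_lipschitz_on (A : set 'rV[R]_n) (phi : 'rV[R]_n -> R) :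
    Prop :=
  forall x, A x ->
    exists2 U, nbhs x U & [lipschitz phi z | z in U `&` A].

Definition locally_lipschitz_differentiable_at (phi : 'rV[R]_n -> R) x : Prop :=
  exists r : R, [/\ 0 < r,
    (forall z, ball x r z ->
       differentiable phi z /\ {for z, continuous (gradient phi)}) &
    [lipschitz (gradient phi z) | z in ball x r]].

End Euclidean.

Section FractionalProgram.
Variables (R : realType) (n : nat).
Variables (f g h : 'rV[R]_n -> R) (C : set 'rV[R]_n).
Implicit Types (x : 'rV[R]_n) (c : R).

Definition Omega : set 'rV[R]_n := [set x | g x != 0].

Definition indicator (A : set 'rV[R]_n) x : \bar R :=
  if x \in A then 0%E else +oo%E.

Definition objective x : \bar R :=
  if x \in Omega `&` C then (f x / g x + h x)%:E else +oo%E.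

Definition lifted x c : \bar R :=
  ((2 * c * f x - c ^+ 2 * f x * g x + h x)%:E + indicator (Omega `&` C) x)%E.

(* Meant for x in Omega `&` C, where lifted x is real-valued and polynomial in
   c, so that neither [fine] nor the totalized derivative returns a default
   value. *)
Definition lifted_dc x c : R := derive1 (fun t : R => fine (lifted x t)) c.

End FractionalProgram.

(* Main.v *)
(* On Omega `&` C the objective and its lifting differ by
     F(z) - F~(z, c) = (f / g)(z) (1 - c g(z))^2 >= 0.
   Stationarity in c at (x, c) says f(x) = 0 or c = 1 / g(x), and in both cases
   the gap vanishes at x, so Fréchet stationarity passes from the minorant F~ to
   F. Conversely, for c = 1 / g(x) the gap is O(|z - x|^2), because the finite
   convex function g is Lipschitz at x and f is bounded near x on Omega; it is
   thus negligible against |z - x|, and stationarity passes from F to F~. *)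
Require Import Defs.
From HB Require Import structures.
From mathcomp Require Import all_boot all_order all_algebra.
From mathcomp Require Import all_classical all_reals all_analysis.
From mathcomp Require Import ring lra.

Import Order.TTheory GRing.Theory Num.Theory.
Import numFieldNormedType.Exports.

Local Open Scope classical_set_scope.
Local Open Scope ring_scope.

Set Implicit Arguments.
Unset Strict Implicit.
Unset Printing Implicit Defensive.

(** * Euclidean norm against sup norm *)

Section EuclideanNorm.
Variables (R : realType) (n : nat).
Implicit Types x y : 'rV[R]_n.

Lemma dot0l x : dot 0 x = 0.
Proof. by rewrite /dot big1 // => i _; rewrite mxE mul0r. Qed.

(** Carries estimates made in the sup norm over to the Euclidean norm of the Fréchet quotient. *)
Lemma norm_le_enorm x : `|x| <= enorm x.
Proof.
rewrite [leLHS]/Num.norm /= mx_normrE; apply/bigmax_leP; split=> [|[i j] _ /=].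
  exact: sqrtr_ge0.
rewrite (ord1 i) -sqrtr_sqr ler_wsqrtr // /dot (bigD1 j) //= expr2 lerDl.
by apply: sumr_ge0 => k _; rewrite -expr2 sqr_ge0.
Qed.

Lemma enorm_gt0 x : x != 0 -> 0 < enorm x.
Proof. by move=> x0; apply: lt_le_trans (norm_le_enorm x); rewrite normr_gt0. Qed.

Lemma near_norm_le x (r : R) : 0 < r -> \forall z \near x, `|z - x| <= r.
Proof.
by move=> r0; apply/nbhs_normP; exists r => //= z /=; rewrite distrC => /ltW.
Qed.

End EuclideanNorm.

(** * Lipschitz bound at a point for finite convex functions *)

Section ConvexFunctions.
Variables (R : realType) (n : nat).
Implicit Types (g : 'rV[R]_n -> R) (x y z : 'rV[R]_n).

Lemma convex_on_spaceP g x y (t : R) : convex_on_space g -> 0 <= t <= 1 ->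
  g (t *: x + (1 - t) *: y) <= t * g x + (1 - t) * g y.
Proof.
move=> gc /andP[t0 t1].
have tI : Itv.spec (@Itv.num_sem R) (Itv.Real `[0%Z, 1%Z]) t.
  by rewrite /= /Itv.num_sem /= realE t0 in_itv /= t0 t1.
exact: (gc (Itv.mk tI) x y (in_setT _) (in_setT _)).
Qed.

Lemma convex_midpoint g x y : convex_on_space g ->
  2 * g x <= g (x + y) + g (x - y).
Proof.
move=> gc; have h : 0 <= (2^-1 : R) <= 1 by lra.
have := convex_on_spaceP (x + y) (x - y) gc h.
have -> : 1 - 2^-1 = 2^-1 :> R by lra.
have -> : 2^-1 *: (x + y) + 2^-1 *: (x - y) = x.
  by rewrite -scalerDr addrACA subrr addr0 -mulr2n -[x *+ 2]scaler_nat scalerA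
             mulVf ?scale1r.
by move=> ?; lra.
Qed.

(** The point [x + a *: y] lies on the segment from [x] to [x + y] or to [x - y], according to the
    sign of [a]; summing both increments gives one slope for both signs. *)
Lemma convex_line_bound g x y (a : R) : convex_on_space g -> `|a| <= 1 ->
  g (x + a *: y) <=
  g x + `|a| * (`|g (x + y) - g x| + `|g (x - y) - g x|).
Proof.
move=> gc; wlog a0 : a y / 0 <= a => [wl a1|].
  have [/wl|/ltW a0] := leP 0 a; first exact.
  have := wl (- a) (- y); rewrite oppr_ge0 normrN scalerN scaleNr !opprK.
  by move=> /(_ a0 a1); rewrite [X in _ + _ * X]addrC.
rewrite ger0_norm // => a1.
have h : 0 <= a <= 1 by rewrite a0.
have := convex_on_spaceP (x + y) x gc h.
have -> : a *: (x + y) + (1 - a) *: x = x + a *: y.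
  by rewrite scalerDr addrAC -scalerDl [a + _]addrC subrK scale1r.
move=> /le_trans; apply.
have := ler_norm (g (x + y) - g x); have := normr_ge0 (g (x - y) - g x).
by move=> p q; nra.
Qed.

(* Peeling off one coordinate direction as the midpoint of [x + 2 u] and
   [x + 2 v] bounds [g (x + u + v)] without Jensen's inequality. *)
Lemma convex_coord_bound g x (s : seq 'I_n) : convex_on_space g ->
  exists L : R, exists2 r : R, 0 < r &
    forall (a : 'I_n -> R) (t : R), t <= r -> (forall i, `|a i| <= t) ->
      g (x + \sum_(i <- s) a i *: delta_mx ord0 i) <= g x + L * t.
Proof.
move=> gc; elim: s => [|i s [L [r r0 IH]]].
  by exists 0, 1 => // a t _ _; rewrite big_nil mul0r !addr0.
pose e : 'rV[R]_n := delta_mx ord0 i.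
pose L0 := `|g (x + e) - g x| + `|g (x - e) - g x|.
have L00 : 0 <= L0 by rewrite addr_ge0.
(* [t <= r / 2] admits the doubled coefficients to the induction hypothesis, and [t <= 2^-1] gives
   [|2 * a i| <= 1]. The midpoint weight cancels the doubling, so the slopes add. *)
exists (L0 + L), (Num.min (r / 2) 2^-1).
  by rewrite lt_min; apply/andP; split; lra.
move=> a t; rewrite le_min => /andP[tr t2] at_; rewrite big_cons.
set S := \sum_(_ <- _) _.
have h : 0 <= (2^-1 : R) <= 1 by lra.
have := convex_on_spaceP (x + (2 * a i) *: e) (x + 2 *: S) gc h.
have -> : 1 - 2^-1 = 2^-1 :> R by lra.
have -> : 2^-1 *: (x + (2 * a i) *: e) + 2^-1 *: (x + 2 *: S)
          = x + (a i *: e + S).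
  rewrite !scalerDr !scalerA mulrA mulVf // mul1r scale1r addrACA.
  by rewrite -scalerDl -div1r -splitr scale1r.
move=> /le_trans; apply.
have aE : `|2 * a i| = 2 * `|a i| by rewrite normrM ger0_norm.
have H1 : g (x + (2 * a i) *: e) <= g x + `|2 * a i| * L0.
  by apply: convex_line_bound => //; rewrite aE; have := at_ i; lra.
have H2 : g (x + 2 *: S) <= g x + L * (2 * t).
  rewrite /S scaler_sumr; under eq_bigr do rewrite scalerA.
  apply: (IH (fun i => 2 * a i)); first by lra.
  by move=> j; rewrite normrM ger0_norm //; have := at_ j; lra.
have := at_ i; rewrite aE in H1; nra.
Qed.

(** The coordinate bound controls [g] from above in every direction; by the midpoint inequality, the
    upper bound at the reflected point [x - (z - x)] is a lower bound at [z]. *)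
Lemma convex_lipschitz_at g x : convex_on_space g ->
  exists L : R, \forall z \near x, `|g z - g x| <= L * `|z - x|.
Proof.
move=> gc; have [L [r r0 H]] := convex_coord_bound x (index_enum 'I_n) gc.
have ub y : `|y| <= r -> g (x + y) <= g x + L * `|y|.
  move=> yr; rewrite {1}(row_sum_delta y).
  apply: (H (fun i => y ord0 i) `|y| yr) => i.
  by rewrite [leRHS]/Num.norm /= mx_normrE; apply/bigmax_geP; right; exists (ord0, i).
exists L; near=> z.
have zr : `|z - x| <= r.
  by near: z; exact: near_norm_le.
have := ub _ zr; have := ub (- (z - x)); rewrite normrN => /(_ zr).
have := convex_midpoint x (z - x) gc; rewrite [x + (z - x)]addrC subrK.
by rewrite ler_norml => *; lra.
Unshelve. all: by end_near. Qed.

End ConvexFunctions.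

(** * Epsilon form of Fréchet stationarity *)

Section FrechetSubdifferential.
Variables (R : realType) (n : nat).
Implicit Types (A : set 'rV[R]_n) (p : 'rV[R]_n -> R) (x : 'rV[R]_n).

(** Stated for filters that may be improper, as [x^'] is when [n = 0]. *)
Lemma limf_einf_ge0P (F : set_system 'rV[R]_n) (u : 'rV[R]_n -> \bar R) :
  Filter F ->
  (0%E <= limf_einf u F)%E <->
  forall e : R, 0 < e -> \forall z \near F, ((- e)%:E <= u z)%E.
Proof.
move=> FF; rewrite limf_einfE; split=> [u0 e e0|u0].
  have : ((- e)%:E < ereal_sup [set ereal_inf (u @` V) | V in F])%E.
    by apply: lt_le_trans u0; rewrite lte_fin oppr_lt0.
  move=> /ereal_sup_gt[_ [V FV <-] eV]; apply: filterS FV => z Vz.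
  by apply: le_trans (ltW eV) _; apply: ereal_inf_lbound; exists z.
apply/lee_addgt0Pr => e e0.
rewrite -leeBlDr // sub0e -EFinN.
apply: le_trans (ereal_sup_ubound _); last first.
  by exists [set z | ((- e)%:E <= u z)%E] => //; exact: u0.
by apply: le_ereal_inf_tmp => _ [z ? <-].
Qed.

(** Multiplying by the norm clears the quotient. Outside [A] the value [+oo] makes the condition
    vacuous, and at [z = x] the inequality is trivial, so the neighbourhood need not be punctured.
    Both the objective and the lifting have this conditional form. *)
Lemma frechet_subdiff0P A p x :
  frechet_subdiff (fun z => if z \in A then (p z)%:E else +oo%E) x 0 <->
  A x /\ forall e : R, 0 < e ->
    \forall z \near x, A z -> p x <= p z + e * enorm (z - x).
Proof.
rewrite /frechet_subdiff /=.
case: (boolP (x \in A)) => xA; last first.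
  by split=> [[]//|[/mem_set]]; rewrite (negbTE xA).
rewrite limf_einf_ge0P.
have Ax := set_mem xA.
have E (e : R) z : z != x ->
    ((- e)%:E <= ((if z \in A then (p z)%:E else +oo) - (p x)%:E
        - (dot 0 (z - x))%:E) * (enorm (z - x))^-1%:E)%E
    <-> (A z -> p x <= p z + e * enorm (z - x)).
  move=> zx; have n0 : 0 < enorm (z - x) by rewrite enorm_gt0 // subr_eq0.
  rewrite lee_pdivlMr // dot0l sube0.
  case: (boolP (z \in A)) => [/set_mem Az|zA].
    rewrite -EFinB -EFinM lee_fin mulNr lerBrDr addrC lerBlDr.
    by split=> // /(_ Az).
  by rewrite addye // leey; split=> // _ /mem_set; rewrite (negbTE zA).
split=> [[_ H]|[_ H]]; split; rewrite ?ltry // => e e0.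
all: have := H e e0; rewrite !near_withinE /= => He; near=> z.
  case: (eqVneq z x) => [-> _|zx].
    by rewrite lerDl mulr_ge0 ?sqrtr_ge0 // ltW.
  by apply/E => //; move: zx; near: z.
move=> zx; apply/E => //; near: z.
Unshelve. all: by end_near. Qed.

End FrechetSubdifferential.

(** * The lifting, its derivative in [c], and its gap to the objective *)

Section Surrogate.
Variables (R : realType) (n : nat).
Variables (f g h : 'rV[R]_n -> R) (C : set 'rV[R]_n).
Implicit Types (x : 'rV[R]_n) (c : R).

Lemma liftedE x c : lifted f g h C x c =
  if x \in Omega g `&` C
  then (2 * c * f x - c ^+ 2 * f x * g x + h x)%:E else +oo%E.
Proof. by rewrite /lifted /indicator; case: ifP; rewrite ?adde0 // addey. Qed.

Lemma lifted_subdiff0P x c :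
  frechet_subdiff (fun z => lifted f g h C z c) x 0 <->
  (Omega g `&` C) x /\ forall e : R, 0 < e -> \forall z \near x,
    (Omega g `&` C) z ->
    2 * c * f x - c ^+ 2 * f x * g x + h x
      <= 2 * c * f z - c ^+ 2 * f z * g z + h z + e * enorm (z - x).
Proof.
rewrite -[X in _ <-> X](@frechet_subdiff0P _ _ _
  (fun z => 2 * c * f z - c ^+ 2 * f z * g z + h z)).
suff -> : (fun z => lifted f g h C z c) = (fun z => if z \in Omega g `&` C
  then (2 * c * f z - c ^+ 2 * f z * g z + h z)%:E else +oo%E) by [].
by apply/funext => z; exact: liftedE.
Qed.

Lemma lifted_dcE x c : (Omega g `&` C) x ->
  lifted_dc f g h C x c = 2 * f x * (1 - c * g x).
Proof.
move=> xA; rewrite /lifted_dc.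
have -> : (fun t : R => fine (lifted f g h C x t)) =
    (fun t => (2 * f x) * t - (f x * g x) * t ^+ 2 + h x).
  by apply/funext => t; rewrite liftedE mem_set //=; ring.
rewrite derive1E.
have D : is_derive c 1 (fun t : R => (2 * f x) * t - (f x * g x) * t ^+ 2 + h x)
   (2 * f x * 1 - f x * g x * (2 * c) + 0).
  by apply: is_derive_eq; rewrite /GRing.scale /=; ring.
by rewrite derive_val; ring.
Qed.

(** Completing the square: [2 * c * a - c ^+ 2 * a * b] is [a / b * (1 - (1 - c * b) ^+ 2)]. *)
Lemma fraction_surrogate_gap (a b k c : R) : b != 0 ->
  a / b + k = 2 * c * a - c ^+ 2 * a * b + k + a / b * (1 - c * b) ^+ 2.
Proof. by move=> b0; field. Qed.

Lemma surrogate_gap_littleo x :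
  (forall z, 0 <= f z) -> (forall z, 0 <= g z) ->
  locally_lipschitz_on (Omega g) f -> convex_on_space g -> Omega g x ->
  forall e : R, 0 < e -> \forall z \near x, Omega g z ->
    f z / g z * (1 - (g x)^-1 * g z) ^+ 2 <= e * enorm (z - x).
Proof.
move=> f0 g0 flip gc gx e e0.
have gx0 : 0 < g x by rewrite lt0r gx g0.
have [U Ux Uf] := flip x gx.
have [K Kf] : exists K : R,
    forall z, U z -> Omega g z -> `|f z - f x| <= K * `|z - x|.
  near (pinfty_nbhs R) => K; exists K => z Uz gz.
  have : K.-lipschitz_(U `&` Omega g) f by near: K; exact: Uf.
  by move=> /(_ (z, x)) /=; apply; split=> //; split=> //; exact: nbhs_singleton.
have [L Lg] := convex_lipschitz_at x gc.
(* [M] bounds [f] on [Omega g] near [x], within distance 1. With [g z >= g x / 2], the quotient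
   [f z / g z] is at most [2 * M / g x], and the square contributes [(L * d) ^+ 2 / (g x) ^+ 2]; [D]
   is the resulting coefficient of [d ^+ 2]. *)
pose M := f x + `|K|; pose D := 2 * M * L ^+ 2 / (g x) ^+ 3.
have M0 : 0 <= M by rewrite addr_ge0.
have D0 : 0 <= D.
  by rewrite divr_ge0 ?exprn_ge0 ?g0 // mulr_ge0 ?sqr_ge0 ?mulr_ge0.
(* The first radius turns [D * d ^+ 2] into at most [e * d], the second keeps [g z >= g x / 2];
   adding 1 keeps the denominators positive. *)
have d0 : 0 < e / (D + 1) by rewrite divr_gt0 // ltr_wpDl.
have l0 : 0 < g x / 2 / (`|L| + 1) by rewrite !divr_gt0 // ltr_wpDl.
near=> z => gz; have gz0 : 0 < g z by rewrite lt0r gz g0.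
have d1 : `|z - x| <= 1 by near: z; exact: near_norm_le.
have dD : `|z - x| <= e / (D + 1) by near: z; exact: near_norm_le.
have dL : `|z - x| <= g x / 2 / (`|L| + 1) by near: z; exact: near_norm_le.
have Uz : U z by near: z.
have Lz : `|g z - g x| <= L * `|z - x| by near: z.
apply: le_trans (_ : e * `|z - x| <= _); last first.
  by rewrite ler_wpM2l ?(ltW e0) // norm_le_enorm.
set d := `|z - x| in d1 dD dL Lz *; have dge0 : 0 <= d by exact: normr_ge0.
have fM : f z <= M.
  have := Kf z Uz gz; rewrite ler_norml -/d => /andP[_].
  have := ler_norm K; have := normr_ge0 K; rewrite /M; nra.
have gh : g x / 2 <= g z.
  have : d * (`|L| + 1) <= g x / 2 by rewrite -ler_pdivlMr // ltr_wpDl.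
  move: Lz; rewrite ler_norml => /andP[+ _].
  have := ler_norm L; have := normr_ge0 L; nra.
have sq : (g z - g x) ^+ 2 <= (L * d) ^+ 2.
  by rewrite -[leLHS]real_normK ?num_real // lerXn2r // nnegrE ?(le_trans _ Lz).
apply: le_trans (_ : D * d ^+ 2 <= _); last first.
  rewrite expr2 mulrA ler_wpM2r //.
  have : d * (D + 1) <= e by rewrite -ler_pdivlMr // ltr_wpDl.
  by nra.
have -> : 1 - (g x)^-1 * g z = (g x - g z) / g x by field; rewrite gt_eqF.
have -> : D * d ^+ 2 = M / (g x / 2) * ((L * d) ^+ 2 / (g x) ^+ 2).
  by rewrite /D; field; rewrite gt_eqF.
rewrite expr_div_n -[X in X / g x ^+ 2]sqrrN opprB.
apply: ler_pM.
- by rewrite divr_ge0.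
- by rewrite divr_ge0 ?sqr_ge0.
- apply: ler_pM => //; first by rewrite invr_ge0 ltW.
  by rewrite lef_pV2 // posrE // divr_gt0.
- by rewrite ler_pM2r // invr_gt0 exprn_gt0.
Unshelve. all: by end_near. Qed.

End Surrogate.

(** * Transfer of stationarity in both directions *)

Theorem proposition4 (R : realType) (n : nat)
    (f g h h1 h2 : 'rV[R]_n -> R) (C : set 'rV[R]_n)
    (f_ge0 : forall x, 0 <= f x) (g_ge0 : forall x, 0 <= g x)
    (f_lsc : lsc f) (g_lsc : lsc g) (h_lsc : lsc h)
    (C_closed : closed C)
    (COmega_neq0 : C `&` Omega g !=set0)
    (f_lip : locally_lipschitz_on (Omega g) f)
    (g_convex : convex_on_space g)
    (h_dec : forall x, h x = h1 x - h2 x)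
    (h1_diff : forall x, Omega g x -> locally_lipschitz_differentiable_at h1 x)
    (h2_convex : convex_on_space h2) :
  (forall xs : 'rV[R]_n,
     frechet_subdiff (objective f g h C) xs 0 ->
     let cs := (g xs)^-1 in
     frechet_subdiff (fun x => lifted f g h C x cs) xs 0 /\
     0 = lifted_dc f g h C xs cs) /\
  (forall (xs : 'rV[R]_n) (cs : R),
     (Omega g `&` C) xs ->
     frechet_subdiff (fun x => lifted f g h C x cs) xs 0 ->
     0 = lifted_dc f g h C xs cs ->
     frechet_subdiff (objective f g h C) xs 0).
Proof.
split=> [xs|xs cs xA].
  move=> /(@frechet_subdiff0P _ _ (Omega g `&` C))[xA Fx] cs.
  have gx : g xs != 0 := xA.1.
  split; last by rewrite lifted_dcE // mulVf // subrr mulr0.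
  apply/lifted_subdiff0P; split=> // e e0.
  (* One half of [e] pays for the stationarity of the objective, the other for the gap at [z]. *)
  have e20 : 0 < e / 2 by rewrite divr_gt0.
  have gap := surrogate_gap_littleo f_ge0 g_ge0 f_lip g_convex gx e20.
  near=> z => zA.
  have : f xs / g xs + h xs <= f z / g z + h z + e / 2 * enorm (z - xs).
    by move: zA; near: z; exact: Fx.
  have : f z / g z * (1 - cs * g z) ^+ 2 <= e / 2 * enorm (z - xs).
    by move: zA.1; near: z.
  rewrite (fraction_surrogate_gap _ _ cs gx).
  rewrite (fraction_surrogate_gap _ _ cs (zA.1 : g z != 0)).
  by rewrite mulVf // subrr expr0n mulr0 addr0; lra.
move=> /lifted_subdiff0P[_ Fx].
rewrite lifted_dcE // => /esym/eqP crit.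
(* Whichever factor of the derivative vanishes, [f xs] or [1 - cs * g xs], it also annihilates the
   gap at [xs]. *)
have {}crit : f xs / g xs * (1 - cs * g xs) ^+ 2 = 0.
  move: crit; rewrite -mulrA mulf_eq0 pnatr_eq0 /= mulf_eq0.
  by move=> /orP[] /eqP ->; rewrite ?mul0r // expr0n mulr0.
apply/(@frechet_subdiff0P _ _ (Omega g `&` C)); split=> // e e0.
have := Fx e e0; apply: filterS => z Fz zA.
rewrite (fraction_surrogate_gap _ _ cs xA.1) crit addr0.
rewrite (fraction_surrogate_gap _ _ cs (zA.1 : g z != 0)).
(* The gap at [z] is nonnegative, so it can only raise the right-hand side. *)
apply: le_trans (Fz zA) _; rewrite lerD2r lerDl.
by rewrite mulr_ge0 ?sqr_ge0 ?divr_ge0.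
Unshelve. all: by end_near. Qed.
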